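(* Let $\mathcal{P}:k^2\dashrightarrow k^3$ be an affine rational parametrization, with nonconstant components, of a surface. Then there exists a rational reparametrization $\mathcal{P}\circ\psi$ (with $\psi:k^2\dashrightarrow k^2$ a rational map) of that surface without affine base points. Moreover, $\deg(\mathcal{P})=\deg(\mathcal{P}\circ\psi)$ as rational maps; in particular, properness is preserved (if $\mathcal{P}$ is proper, i.e. birational onto the surface, then so is $\mathcal{P}\circ\psi$).
   Context: $k$ is an algebraically closed field of characteristic zero. A surface is an irreducible Zariski-closed subset of $k^3$ of dimension 2. A rational parametrization of a surface $S$ is a triple of rational functions in $k(s,t)$ defining a dominant rational map $k^2\dashrightarrow S$; its degree is the degree of this dominant rational map, i.e. the degree of the field extension $k(s,t)/k(S)$. Write a parametrization with a common denominator as $\left(\frac{p_1}{q},\frac{p_2}{q},\frac{p_3}{q}\right)$ with $p_1,p_2,p_3,q\in k[s,t]$ and $\gcd(p_1,p_2,p_3,q)=1$. Its affine base points are the points $(s_0,t_0)\in k^2$ with $p_1(s_0,t_0)=p_2(s_0,t_0)=p_3(s_0,t_0)=q(s_0,t_0)=0$. *)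

(* Defs.v *)
From mathcomp Require Import all_boot all_order all_algebra.
From mathcomp Require Import mpoly.
From mathcomp Require Import classical_sets.

Set Implicit Arguments.
Unset Strict Implicit.
Unset Printing Implicit Defensive.

Import GRing.Theory.
Local Open Scope classical_set_scope.
Local Open Scope ring_scope.

Section Zariski.
Variables (k : closedFieldType) (n : nat).
Implicit Types A Z : set ('I_n -> k).

Definition zariski_closed Z : Prop :=
  exists I : set {mpoly k[n]}, Z = [set v | forall f, I f -> f.@[v] = 0].

Definition zariski_closure A : set ('I_n -> k) :=
  [set v | forall f : {mpoly k[n]}, (forall w, A w -> f.@[w] = 0) -> f.@[v] = 0].

Definition zariski_irreducible Z : Prop :=
  Z !=set0 /\
  forall Z1 Z2, zariski_closed Z1 -> zariski_closed Z2 ->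
    Z `<=` Z1 `|` Z2 -> Z `<=` Z1 \/ Z `<=` Z2.

Definition irreducible_chain Z (d : nat) : Prop :=
  exists C : nat -> set ('I_n -> k),
    [/\ forall i, (i <= d)%N ->
          [/\ zariski_closed (C i), zariski_irreducible (C i) & C i `<=` Z]
      & forall i, (i < d)%N -> C i `<` C i.+1].

Definition krull_dimension Z (d : nat) : Prop :=
  irreducible_chain Z d /\ ~ irreducible_chain Z d.+1.

End Zariski.

Definition surface (k : closedFieldType) (S : set ('I_3 -> k)) : Prop :=
  [/\ zariski_closed S, zariski_irreducible S & krull_dimension S 2].

Section RationalFunctions.
Variable k : closedFieldType.

Definition ratfun (n : nat) := {fraction {mpoly k[n]}}.

Definition frac_of (n : nat) (p : {mpoly k[n]}) : ratfun n :=
  @FracField.tofrac {mpoly k[n]} p.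

Definition nonconstant (n : nat) (f : ratfun n) : Prop :=
  forall c : k, f <> frac_of c%:MP.

(* f is regular at v with value c. The fraction a / b may depend on v. *)
Definition ratfun_value (n : nat) (f : ratfun n) (v : 'I_n -> k) (c : k) : Prop :=
  exists a b : {mpoly k[n]},
    [/\ b.@[v] != 0, f = frac_of a / frac_of b & c = a.@[v] / b.@[v]].

Definition ratmap_value (n m : nat) (P : 'I_m -> ratfun n)
    (v : 'I_n -> k) (w : 'I_m -> k) : Prop :=
  forall i, ratfun_value (P i) v (w i).

Definition poly_subst (n m : nat) (g : {mpoly k[m]}) (P : 'I_m -> ratfun n) :
    ratfun n :=
  mmap (fun c : k => frac_of c%:MP) P g.

(* u is the composite of f with psi. Not every f can be composed with psi: some
   fraction representing f must have a denominator that psi does not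
   annihilate. The composite does not depend on that fraction. *)
Definition ratfun_comp (n m : nat) (f : ratfun m) (psi : 'I_m -> ratfun n)
    (u : ratfun n) : Prop :=
  exists a b : {mpoly k[m]},
    [/\ poly_subst b psi != 0, f = frac_of a / frac_of b
      & u = poly_subst a psi / poly_subst b psi].

Definition ratmap_comp (n m l : nat) (P : 'I_l -> ratfun m)
    (psi : 'I_m -> ratfun n) (Q : 'I_l -> ratfun n) : Prop :=
  forall i, ratfun_comp (P i) psi (Q i).

End RationalFunctions.

Section Parametrizations.
Variable k : closedFieldType.
Implicit Types (S : set ('I_3 -> k)) (P : 'I_3 -> ratfun k 2).

(* P takes its values in S, and they are dense in S. *)
Definition parametrizes P S : Prop :=
  zariski_closure [set w | exists v, ratmap_value P v w] = S.

(* The last clause is gcd(p_1, p_2, p_3, q) = 1; the units of k[s, t] are the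
   nonzero constants. *)
Definition common_denominator_form P (p : 'I_3 -> {mpoly k[2]})
    (q : {mpoly k[2]}) : Prop :=
  [/\ q != 0, forall i, P i = frac_of (p i) / frac_of q
    & forall d : {mpoly k[2]},
        (exists c, q = c * d) -> (forall i, exists c, p i = c * d) ->
        d \is a GRing.unit].

Definition common_zero (p : 'I_3 -> {mpoly k[2]}) (q : {mpoly k[2]})
    (v : 'I_2 -> k) : Prop :=
  (forall i, (p i).@[v] = 0) /\ q.@[v] = 0.

(* A form as above exists and is unique up to a common nonzero constant, so the
   base points do not depend on the choice of (p, q). *)
Definition no_affine_base_points P : Prop :=
  exists p q, common_denominator_form P p q /\ forall v, ~ common_zero p q v.

(* The image of the function field k(S) in k(s, t) under composition with P. *)
Definition function_field_image P S : set (ratfun k 2) :=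
  [set u | exists g h : {mpoly k[3]},
     (exists2 w, S w & h.@[w] != 0) /\ u = poly_subst g P / poly_subst h P].

(* L is a vector space of dimension d over its subfield K. *)
Definition extension_degree (L : fieldType) (K : set L) (d : nat) : Prop :=
  exists b : 'I_d -> L,
    (forall x, exists2 c : 'I_d -> L,
       forall i, K (c i) & x = \sum_(i < d) c i * b i) /\
    (forall c : 'I_d -> L, (forall i, K (c i)) ->
       \sum_(i < d) c i * b i = 0 -> forall i, c i = 0).

Definition map_degree P S (d : nat) : Prop :=
  @extension_degree {fraction {mpoly k[2]}} (function_field_image P S) d.

(* P is birational onto S: the rational map (g_0 / h_0, g_1 / h_1) from S to the
   plane is inverse to P, both composites being the identity wherever they are
   defined. *)
Definition proper_parametrization P S : Prop :=
  exists g h : 'I_2 -> {mpoly k[3]},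
    [/\ exists2 w, S w & forall j, (h j).@[w] != 0,
        forall v w, ratmap_value P v w -> (forall j, (h j).@[w] != 0) ->
          v =1 (fun j => (g j).@[w] / (h j).@[w])
      & forall w u, S w -> (forall j, (h j).@[w] != 0) ->
          ratmap_value P (fun j => (g j).@[w] / (h j).@[w]) u -> u =1 w].

End Parametrizations.

(* Main.v *)
(** Write P = (p_0/q, p_1/q, p_2/q) with p_0, p_1, p_2, q coprime in k[s, t].
    The ideal (p_0, p_1, p_2, q) then contains a nonzero h(s), so that every
    base point lies on one of the finitely many lines h(s) = 0, and each of
    these lines contains finitely many base points.  Choose c such that no
    base point lies on both h(s) = 0 and t = c, and let
    psi(s, t) = (s, c + t h(s)).  This polynomial map sends the lines h(s) = 0
    to points with t = c and preserves s, so its image avoids the base points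
    of P; and it is birational, so it induces an automorphism of k(s, t) over k
    which carries P to its reparametrization and thereby transports density of
    the image, the subfield k(S) and properness. *)
Require Import Defs.
From HB Require Import structures.
From mathcomp Require Import all_boot all_order all_algebra.
From mathcomp Require Import mpoly.
From mathcomp Require Import boolp classical_sets.
Set Implicit Arguments.
Unset Strict Implicit.
Unset Printing Implicit Defensive.
Import GRing.Theory.
Local Open Scope ring_scope.

Lemma ex_minimal (P : nat -> Prop) :
  (exists n, P n) -> exists2 n, P n & forall m, P m -> (n <= m)%N.
Proof.
case=> n0 Pn0; have ex : exists n, `[< P n >] by exists n0; apply/asboolP.
case: (ex_minnP ex) => n /asboolP Pn min_n.
by exists n => // m Pm; apply: min_n; apply/asboolP.
Qed.

(** * Polynomials in s and t as elements of [{poly {poly k}}]: restriction to lines and Gauss's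
    lemma *)

Section Bivariate.
Variable k : closedFieldType.
Implicit Types (a b : k) (c h : {poly k}) (f d : {poly {poly k}}).

(** The outer variable is t and the inner one s: [f.[b%:P].[a]] is the value at s = a, t = b, and
    [spec a] restricts to the line s = a. *)
Definition spec a f : {poly k} := map_poly (horner_eval a) f.

Lemma specC a c : spec a c%:P = (c.[a])%:P.
Proof. exact: map_polyC. Qed.

Lemma specM a f g : spec a (f * g) = spec a f * spec a g.
Proof. exact: rmorphM. Qed.

Lemma horner_spec a b f : (spec a f).[b] = f.[b%:P].[a].
Proof. by rewrite -[b in LHS](hornerC b a) horner_map. Qed.

Lemma spec_eq0 a f : spec a f = 0 -> exists f', f = ('X - a%:P)%:P * f'.
Proof.
move=> f_a; exists (\poly_(i < size f) (f`_i %/ ('X - a%:P))).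
apply/polyP => i; rewrite coefCM coef_poly mulrC.
case: ltnP => [_|le_i]; last by rewrite mul0r nth_default.
rewrite Pdiv.Field.divpK // dvdp_XsubCl; apply/rootP.
by have := congr1 (fun p : {poly k} => p`_i) f_a; rewrite coef_map coef0.
Qed.

Lemma biv_nonroot f : f != 0 -> exists a b, f.[b%:P].[a] != 0.
Proof.
rewrite -lead_coef_eq0 => /closed_nonrootP [a nra]; exists a.
have: spec a f != 0.
  apply: contraNneq nra => f_a.
  have := congr1 (fun p : {poly k} => p`_(size f).-1) f_a.
  by rewrite coef_map coef0 => /rootP.
by case/closed_nonrootP => b; rewrite rootE horner_spec; exists b.
Qed.

(** Each restriction [spec a f] has no root, hence is constant. The higher coefficients of [f] thus
    vanish at every a and are zero; the remaining polynomial in s has no root either. *)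
Lemma biv_no_zero_unit f :
  (forall a b, f.[b%:P].[a] != 0) -> f \is a GRing.unit.
Proof.
move=> nz.
have sz1 a : size (spec a f) = 1.
  apply/eqP; apply: contraT => /closed_rootP [b].
  by rewrite rootE horner_spec (negPf (nz a b)).
have f_const : f = (f`_0)%:P.
  apply/polyP => i; rewrite coefC; case: eqVneq => [->//|i_gt0].
  apply/eqP; apply: contraT => /closed_nonrootP [a]; rewrite rootE => /negP[].
  have -> : (f`_i).[a] = (spec a f)`_i by rewrite coef_map.
  by rewrite nth_default // sz1 lt0n.
rewrite f_const poly_unitE size_polyC coefC eqxx.
have szf : size f`_0 == 1.
  apply: contraT => /closed_rootP [a].
  by move/rootP => fa; have := nz a 0; rewrite f_const hornerC fa eqxx.
have f0 : f`_0 != 0 by rewrite -size_poly_eq0 (eqP szf).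
rewrite f0 poly_unitE szf unitfE /=.
by rewrite (size1_polyC (eq_leq (eqP szf))) polyC_eq0 in f0.
Qed.

Lemma size_XsubC_mul a c : c != 0 -> size (('X - a%:P) * c) = (size c).+1.
Proof. by move=> c_neq0; rewrite size_monicM ?monicXsubC // size_XsubC. Qed.

(** Over an algebraically closed field a nontrivial content has a factor ['X - a%:P], so primitivity
    can be tested on the lines s = a. Splitting off such factors stops because each one lowers the
    degree in s of the leading coefficient. *)
Lemma primitive_part f : f != 0 ->
  exists2 c, c != 0 & exists2 d, f = c%:P * d & forall a, spec a d != 0.
Proof.
have [n] := ubnP (size (lead_coef f)).
elim: n f => // n IHn f lt_n f_neq0.
have [prim|] := pselect (forall a, spec a f != 0).
  by exists 1; rewrite ?oner_eq0 //; exists f; rewrite ?mul1r.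
case/existsNP => a /negP; rewrite negbK => /eqP /spec_eq0 [f' def_f].
have Xa_neq0 : 'X - a%:P != 0 :> {poly k} by rewrite polyXsubC_eq0.
have f'_neq0 : f' != 0 by apply: contraNneq f_neq0 => f'0; rewrite def_f f'0 mulr0.
have [] := IHn f' _ f'_neq0.
  move: lt_n; rewrite def_f lead_coefM lead_coefC size_XsubC_mul //.
  by rewrite lead_coef_eq0.
move=> c c_neq0 [d def_f' prim_d]; exists (('X - a%:P) * c); first by rewrite mulf_neq0.
by exists d => //; rewrite def_f def_f' mulrA polyCM.
Qed.

(* Gauss's lemma: the factors 'X - a of c are cancelled one at a time. *)
Lemma primitive_dvd d e c f : (forall a, spec a d != 0) -> c != 0 ->
  e * d = c%:P * f -> exists e', f = e' * d.
Proof.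
move=> prim_d; have [n] := ubnP (size c).
elim: n c e => // n IHn c e lt_n c_neq0 def_ed.
have [|] := boolP (size c == 1).
  case/size_poly1P => u u_neq0 def_c; exists ((u^-1)%:P%:P * e).
  by rewrite -mulrA def_ed def_c mulrA -!polyCM mulVf // !polyC1 mul1r.
case/closed_rootP => a /factor_theorem [c' def_c].
have Xa_neq0 : 'X - a%:P != 0 :> {poly k} by rewrite polyXsubC_eq0.
have c'_neq0 : c' != 0 by apply: contraNneq c_neq0 => c0; rewrite def_c c0 mul0r.
have /eqP : spec a (e * d) = 0.
  by rewrite def_ed specM specC def_c !hornerE subrr mulr0 polyC0 mul0r.
rewrite specM mulf_eq0 (negPf (prim_d a)) orbF => /eqP /spec_eq0 [e' def_e].
apply: (IHn c' e') => //.
  by move: lt_n; rewrite def_c mulrC size_XsubC_mul.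
apply: (@mulfI _ ('X - a%:P)%:P); first by rewrite polyC_eq0.
by rewrite mulrA -def_e def_ed def_c polyCM mulrCA !mulrA.
Qed.

(** * Eliminating t from a coprime ideal [I] of k[s, t] *)

Section Elimination.
Variable I : {poly {poly k}} -> Prop.
Hypothesis I_add : forall f g, I f -> I g -> I (f + g).
Hypothesis I_mul : forall f g, I f -> I (g * f).
Hypothesis I_neq0 : exists2 f, I f & f != 0.
Hypothesis I_coprime :
  forall d, (forall f, I f -> exists e, f = e * d) -> d \is a GRing.unit.

(** Take a nonzero [f] in [I] of least degree in t and write f = c d with [d] primitive.
    Pseudo-division of any g in [I] by [f] leaves remainder 0 by minimality, and Gauss's lemma
    cancels the power of the leading coefficient, so [d] divides g. Hence [d] is a unit and [f]
    involves s alone. *)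
Lemma eliminant : exists2 h, h != 0 & I h%:P.
Proof.
have [|_ [f [If f_neq0 <-] min_f]] :=
    @ex_minimal (fun n => exists f, [/\ I f, f != 0 & size f = n]).
  by case: I_neq0 => f; exists (size f); exists f.
have [c c_neq0 [d def_f prim_d]] := primitive_part f_neq0.
have/I_coprime : forall g, I g -> exists e, g = e * d.
  move=> g Ig; have := Pdiv.Idomain.divp_eq g f.
  have Ir : I (g %% f).
    have -> : g %% f = (lead_coef f ^+ scalp g f)%:P * g + (- (g %/ f)) * f.
      by rewrite mul_polyC Pdiv.Idomain.divp_eq mulNr addrAC subrr add0r.
    by apply: I_add; apply: I_mul.
  have -> : g %% f = 0.
    apply/eqP; apply: contraT => r_neq0; have := min_f _ (ex_intro _ _ (And3 Ir r_neq0 erefl)).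
    by rewrite leqNgt Pdiv.Idomain.ltn_modpN0.
  rewrite addr0 def_f mulrA -mul_polyC => /esym.
  by apply: (primitive_dvd prim_d); apply: Pdiv.Idomain.lc_expn_scalp_neq0.
rewrite poly_unitE => /andP[sz_d _]; exists (c * d`_0).
  apply: contraNneq f_neq0 => /(congr1 polyC); rewrite polyC0 polyCM => <-.
  by rewrite -size1_polyC ?(eqP sz_d) // def_f.
by rewrite polyCM -size1_polyC ?(eqP sz_d) // -def_f.
Qed.

Lemma avoiding_coordinate (r : seq k) :
  exists b, forall a, a \in r -> exists2 f, I f & f.[b%:P].[a] != 0.
Proof.
(* [g] is a product over a in [r] of restrictions to the lines s = a of members of [I]; any non-root
   of [g] serves as b. *)
suff [g] : exists2 g : {poly k}, g != 0 & forall b, g.[b] != 0 ->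
    forall a, a \in r -> exists2 f, I f & f.[b%:P].[a] != 0.
  by case/closed_nonrootP => b; rewrite rootE => gb Hg; exists b; apply: Hg.
elim: r => [|a r [g g_neq0 Hg]]; first by exists 1; rewrite ?oner_eq0.
(* If all of [I] vanished on the line s = a, the nonunit ['X - a%:P] would divide every member. *)
have [f If f_a] : exists2 f, I f & spec a f != 0.
  apply: contrapT => no_f.
  have/I_coprime : forall f, I f -> exists e, f = e * ('X - a%:P)%:P.
    move=> f If; have [|f' ->] := @spec_eq0 a f; last by exists f'; rewrite mulrC.
    by apply/eqP; apply: contraT => f_a; case: no_f; exists f.
  by rewrite poly_unitE coefC eqxx poly_unitE size_XsubC andbF.
exists (spec a f * g) => [|b]; first by rewrite mulf_neq0.
rewrite hornerM mulf_eq0 negb_or horner_spec => /andP[fb gb] a'.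
by rewrite inE => /orP[/eqP->|/Hg]; [exists f | apply].
Qed.

Lemma separating_line : exists h b, [/\ h != 0, I h%:P &
  forall a, h.[a] = 0 -> exists2 f, I f & f.[b%:P].[a] != 0].
Proof.
have [h h_neq0 Ih] := eliminant; have [r def_h] := closed_field_poly_normal h.
have [b Hb] := avoiding_coordinate r; exists h, b; split=> // a ha; apply: Hb.
have: root h a by apply/rootP.
by rewrite def_h rootZ ?lead_coef_eq0 // root_prod_XsubC.
Qed.

End Elimination.

End Bivariate.

(** * Morphisms out of [{mpoly R[n]}] and the isomorphism of [{mpoly k[2]}] with
    [{poly {poly k}}] *)

Lemma mpoly_ring_ind (R : comNzRingType) n (Q : {mpoly R[n]} -> Prop) :
  (forall c, Q c%:MP) -> (forall i, Q 'X_i) ->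
  (forall f g, Q f -> Q g -> Q (f + g)) ->
  (forall f g, Q f -> Q g -> Q (f * g)) -> forall f, Q f.
Proof.
move=> QC QX QD QM f; rewrite [f]mpolyE.
elim/big_ind: _ => [|f1 f2|m _]; [by rewrite -mpolyC0 | exact: QD |].
rewrite -mul_mpolyC mpolyXE_id; apply: (QM) => //.
elim/big_ind: _ => [|f1 f2|i _]; [by rewrite -mpolyC1 | exact: QM |].
by elim: (m i) => [|e IHe]; rewrite ?expr0 -?mpolyC1 // exprS; apply: (QM).
Qed.

Lemma eq_mpoly_rmorph (R : comNzRingType) n (T : nzRingType)
    (f g : {rmorphism {mpoly R[n]} -> T}) :
  (forall c, f c%:MP = g c%:MP) -> (forall i, f 'X_i = g 'X_i) -> f =1 g.
Proof.
move=> fgC fgX; apply: mpoly_ring_ind => // p q fg_p fg_q.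
  by rewrite !rmorphD fg_p fg_q.
by rewrite !rmorphM fg_p fg_q.
Qed.

Section ToBivariate.
Variable k : closedFieldType.
Implicit Types (f : {mpoly k[2]}) (v : 'I_2 -> k).

Definition to_biv : {rmorphism {mpoly k[2]} -> {poly {poly k}}} :=
  mmap (polyC \o polyC) (fun i => if i == 0 then 'X%:P else 'X).

Definition of_poly : {rmorphism {poly k} -> {mpoly k[2]}} :=
  horner_morph (fun c => mulrC 'X_(0 : 'I_2) (@mpolyC 2 k c)).

Definition of_biv : {rmorphism {poly {poly k}} -> {mpoly k[2]}} :=
  horner_morph (fun c => mulrC 'X_(1 : 'I_2) (of_poly c)).

Lemma to_bivC c : to_biv c%:MP = c%:P%:P.
Proof. exact: mmapC. Qed.

Lemma to_bivX i : to_biv 'X_i = if i == 0 then 'X%:P else 'X.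
Proof. by rewrite [LHS]mmapX mmap1U. Qed.

Lemma of_polyC c : of_poly c%:P = c%:MP.
Proof. exact: horner_morphC. Qed.

Lemma of_polyX : of_poly 'X = 'X_0.
Proof. exact: horner_morphX. Qed.

Lemma of_bivC c : of_biv c%:P = of_poly c.
Proof. exact: horner_morphC. Qed.

Lemma of_bivX : of_biv 'X = 'X_1.
Proof. exact: horner_morphX. Qed.

Lemma to_bivK : cancel to_biv of_biv.
Proof.
apply: (@eq_mpoly_rmorph _ _ _ (of_biv \o to_biv) idfun) => [c|i] /=.
  by rewrite to_bivC of_bivC of_polyC.
rewrite to_bivX; case: eqVneq => [->|]; first by rewrite of_bivC of_polyX.
by case: i => -[|[|//]] // lt_i2 _; rewrite of_bivX; congr 'X__; apply: val_inj.
Qed.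

Lemma to_biv_of_poly c : to_biv (of_poly c) = c%:P.
Proof.
elim/poly_ind: c => [|c a IHc]; first by rewrite !rmorph0.
by rewrite !rmorphD !rmorphM /= IHc of_polyX of_polyC to_bivX to_bivC.
Qed.

Lemma of_poly_neq0 c : c != 0 -> of_poly c != 0.
Proof.
apply: contraNneq => /(congr1 to_biv)/eqP.
by rewrite to_biv_of_poly rmorph0 polyC_eq0.
Qed.

Lemma of_bivK : cancel of_biv to_biv.
Proof.
elim/poly_ind => [|f c IHf]; first by rewrite !rmorph0.
by rewrite !rmorphD !rmorphM /= IHf of_bivX of_bivC to_bivX /= to_biv_of_poly.
Qed.

Lemma meval_to_biv f v : f.@[v] = (to_biv f).[(v 1)%:P].[v 0].
Proof.
apply: (@eq_mpoly_rmorph _ _ _ (meval v)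
  (horner_eval (v 0) \o horner_eval (v 1)%:P \o to_biv)) => [c|i] /=.
  by rewrite mevalC to_bivC /horner_eval !hornerC.
rewrite mevalXU to_bivX /horner_eval; case: eqVneq => [->|].
  by rewrite hornerC hornerX.
case: i => -[|[|//]] // lt_i2 _; rewrite hornerX hornerC.
by congr v; apply: val_inj.
Qed.

Lemma meval_of_poly c v : (of_poly c).@[v] = c.[v 0].
Proof. by rewrite meval_to_biv to_biv_of_poly hornerC. Qed.

Let pt (a b : k) (i : 'I_2) := if i == 0 then a else b.

Lemma mpoly2_eq0 f : (forall v, f.@[v] = 0) -> f = 0.
Proof.
move=> f0; apply: (can_inj to_bivK); rewrite rmorph0; apply/eqP.
apply: contraT => /biv_nonroot [a [b]].
by have := f0 (pt a b); rewrite meval_to_biv => ->; rewrite eqxx.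
Qed.

Lemma mpoly2_no_zero_unit f : (forall v, f.@[v] != 0) -> f \is a GRing.unit.
Proof.
move=> nz; rewrite -[f]to_bivK rmorph_unit // biv_no_zero_unit // => a b.
by have := nz (pt a b); rewrite meval_to_biv.
Qed.

End ToBivariate.

Arguments to_biv {k}.
Arguments of_poly {k}.
Arguments of_biv {k}.

(** * Fraction fields and their universal property *)

Section FractionField.
Variable R : idomainType.
Local Notation frac := (@FracField.tofrac R).

Lemma fractionP (x : {fraction R}) : exists a b, b != 0 /\ x = frac a / frac b.
Proof.
elim/quotW: x => x; exists \n_x, \d_x; split; first exact: denom_ratioP.
have d_neq0 : \d_x != 0 := denom_ratioP x.
apply: (canRL (mulfK _)); first by rewrite tofrac_eq0.
unlock FracField.tofrac; rewrite -[LHS]FracField.pi_mul; apply/eqmodP => /=.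
rewrite FracField.equivfE /FracField.mulf !numden_Ratio ?oner_eq0 ?mulr1 //.
by rewrite mulrC.
Qed.

Lemma frac_div_eq (a b a' b' : R) : b != 0 -> b' != 0 ->
  (frac a / frac b == frac a' / frac b') = (a * b' == a' * b).
Proof.
move=> b0 b'0; rewrite eqr_div ?tofrac_eq0 //.
by rewrite -!tofracM tofrac_eq.
Qed.

(** Cross-multiplication shows that phi a / phi b depends only on the fraction a / b; [choice] then
    gives the function, which is packed as a morphism. *)
Lemma fraction_lift (F : fieldType) (phi : {rmorphism R -> F}) :
  (forall x, x != 0 -> phi x != 0) ->
  exists Phi : {rmorphism {fraction R} -> F}, forall x, Phi (frac x) = phi x.
Proof.
move=> phi_neq0.
have [Phi PhiE] : exists Phi : {fraction R} -> F, forall a b, b != 0 ->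
    Phi (frac a / frac b) = phi a / phi b.
  have exPhi x : exists y, forall a b, b != 0 -> x = frac a / frac b ->
      y = phi a / phi b.
    have [a [b [b0 ->]]] := fractionP x; exists (phi a / phi b) => a' b' b'0 /eqP.
    rewrite frac_div_eq // => /eqP/(congr1 phi) eq_ab; apply/eqP.
    by rewrite eqr_div ?phi_neq0 // -!rmorphM eq_ab.
  by have [Phi HPhi] := choice exPhi; exists Phi => a b b0; apply: HPhi.
have Phi_frac a : Phi (frac a) = phi a.
  by have := PhiE a 1 (oner_neq0 _); rewrite !rmorph1 !divr1.
have PhiB : zmod_morphism Phi.
  move=> x y; have [a [b [b0 ->]]] := fractionP x; have [c [d [d0 ->]]] := fractionP y.
  rewrite -mulNr addf_div ?tofrac_eq0 // -tofracN -!tofracM -tofracD.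
  rewrite !PhiE ?mulf_neq0 // rmorphD !rmorphM rmorphN /=.
  by rewrite -mulNr addf_div ?phi_neq0.
have PhiM : monoid_morphism Phi.
  split=> [|x y]; first by rewrite -tofrac1 Phi_frac rmorph1.
  have [a [b [b0 ->]]] := fractionP x; have [c [d [d0 ->]]] := fractionP y.
  by rewrite mulf_div -!tofracM !PhiE ?mulf_neq0 // !rmorphM mulf_div.
pose mA := GRing.isZmodMorphism.Build _ _ Phi PhiB.
pose mM := GRing.isMonoidMorphism.Build _ _ Phi PhiM.
pose Phi' : {rmorphism {fraction R} -> F} := HB.pack Phi mA mM.
by exists Phi'.
Qed.

End FractionField.

(** * Substitution into rational functions and their values at points *)

Section RationalMaps.
Variable k : closedFieldType.

Lemma frac_of_eq0 n (a : {mpoly k[n]}) : (frac_of a == 0) = (a == 0).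
Proof. exact: tofrac_eq0. Qed.

Lemma frac_ofD n : {morph @frac_of k n : a b / a + b}.
Proof. exact: tofracD. Qed.

Lemma frac_ofM n : {morph @frac_of k n : a b / a * b}.
Proof. exact: tofracM. Qed.

Lemma ratfunP n (x : ratfun k n) :
  exists a b, b != 0 /\ x = frac_of a / frac_of b.
Proof. exact: fractionP. Qed.

Definition const_ratfun n : {rmorphism k -> ratfun k n} :=
  @FracField.tofrac {mpoly k[n]} \o @mpolyC n k.

(** This is [poly_subst] with the coefficient map bundled as a morphism, so that substitution is
    itself a ring morphism. *)
Definition eval_ratfun n m (P : 'I_m -> ratfun k n) (g : {mpoly k[m]}) : ratfun k n :=
  mmap (const_ratfun n) P g.

HB.instance Definition _ n m (P : 'I_m -> ratfun k n) :=
  GRing.RMorphism.copy (eval_ratfun P) (mmap (const_ratfun n) P).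

Lemma poly_subst_eval n m (P : 'I_m -> ratfun k n) g : poly_subst g P = eval_ratfun P g.
Proof. by []. Qed.

Lemma eval_ratfunC n m (P : 'I_m -> ratfun k n) c : eval_ratfun P c%:MP = frac_of c%:MP.
Proof. exact: mmapC. Qed.

Lemma eval_ratfunX n m (P : 'I_m -> ratfun k n) i : eval_ratfun P 'X_i = P i.
Proof. by rewrite [LHS]mmapX mmap1U. Qed.

Lemma eval_ratfun_frac_of n m (psi : 'I_m -> {mpoly k[n]}) (g : {mpoly k[m]}) :
  eval_ratfun (fun i => frac_of (psi i)) g = frac_of (mmap (@mpolyC n k) psi g).
Proof.
apply: (@eq_mpoly_rmorph _ _ _ (eval_ratfun (fun i => frac_of (psi i)))
  (@FracField.tofrac {mpoly k[n]} \o mmap (@mpolyC n k) psi)) => [c|i] /=.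
  by rewrite eval_ratfunC mmapC.
by rewrite eval_ratfunX mmapX mmap1U.
Qed.

Lemma eval_ratfun_X n (a : {mpoly k[n]}) :
  eval_ratfun (fun i => frac_of 'X_i) a = frac_of a.
Proof.
apply: (@eq_mpoly_rmorph _ _ _ (eval_ratfun (fun i => frac_of 'X_i))
  (@FracField.tofrac {mpoly k[n]})) => [c|i] /=; first by rewrite eval_ratfunC.
by rewrite eval_ratfunX.
Qed.

Lemma common_denominator n m (P : 'I_m -> ratfun k n) :
  exists p q, q != 0 /\ forall i, P i = frac_of (p i) / frac_of q.
Proof.
have /choice [a /choice [b ab]] i := fractionP (P i).
exists (fun i => a i * \prod_(j | j != i) b j), (\prod_j b j); split=> [|i].
  by apply/prodf_neq0 => i _; case: (ab i).
have [bi0 ->] := ab i; apply/eqP; rewrite frac_div_eq //; last first.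
  by apply/prodf_neq0 => j _; case: (ab j).
by rewrite (bigD1 i) //= -mulrA [_ * b i]mulrC.
Qed.

(* Quantifying over e lets the same G and N serve both for composition with a
   rational map and for evaluation at a point. *)
Lemma clear_denominators n m (g h : 'I_n -> {mpoly k[m]}) (a : {mpoly k[n]}) :
  exists G N, forall (F : fieldType) (e : {rmorphism {mpoly k[m]} -> F}),
    (forall j, e (h j) != 0) ->
    e G = e (\prod_j h j) ^+ N *
          mmap (e \o @mpolyC m k) (fun j => e (g j) / e (h j)) a.
Proof.
elim/mpoly_ring_ind: a => [c|i|a a'|a a'].
- by exists c%:MP, 0 => F e h0; rewrite expr0 mul1r mmapC.
- exists (g i * \prod_(j | j != i) h j), 1 => F e h0.
  rewrite expr1 mmapX mmap1U [in RHS](bigD1 i) //= !rmorphM.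
  by rewrite [e (h i) * _]mulrC -mulrA [e (h i) * _]mulrC divfK // mulrC.
- move=> [G [N HG]] [G' [N' HG']].
  exists ((\prod_j h j) ^+ N' * G + (\prod_j h j) ^+ N * G'), (N + N')%N.
  move=> F e h0; rewrite rmorphD !rmorphM !rmorphXn HG // HG' // mmapD /=.
  by rewrite !mulrA -!exprD addnC -mulrDr.
- move=> [G [N HG]] [G' [N' HG']].
  exists (G * G'), (N + N')%N => F e h0.
  by rewrite !rmorphM HG // HG' // exprD mulrACA.
Qed.

Section Values.
Variable n : nat.
Implicit Types (x y : ratfun k n) (v : 'I_n -> k).

Lemma ratfun_value_inj x v c c' :
  ratfun_value x v c -> ratfun_value x v c' -> c = c'.
Proof.
case=> a [b [b0 -> ->]] [a' [b' [b'0 + ->]]].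
have nz d : d.@[v] != 0 -> d != 0 by apply: contraNneq => ->; rewrite meval0.
move/eqP; rewrite frac_div_eq ?nz // => /eqP/(congr1 (meval v)) eq_ab.
by apply/eqP; rewrite eqr_div // -!mevalM eq_ab.
Qed.

Lemma ratfun_value_frac_of (a : {mpoly k[n]}) v : ratfun_value (frac_of a) v a.@[v].
Proof. by exists a, 1; rewrite meval1 oner_eq0 /frac_of tofrac1 !divr1. Qed.

Lemma ratfun_valueD x y v c d :
  ratfun_value x v c -> ratfun_value y v d -> ratfun_value (x + y) v (c + d).
Proof.
have nz (e : {mpoly k[n]}) : e.@[v] != 0 -> frac_of e != 0.
  by rewrite frac_of_eq0; apply: contraNneq => ->; rewrite meval0.
case=> a [b [b0 -> ->]] [a' [b' [b'0 -> ->]]].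
exists (a * b' + a' * b), (b * b'); rewrite mevalM mulf_neq0 //; split=> //.
  by rewrite addf_div ?nz // -!frac_ofM -frac_ofD.
by rewrite addf_div // mevalD !mevalM.
Qed.

Lemma ratfun_valueM x y v c d :
  ratfun_value x v c -> ratfun_value y v d -> ratfun_value (x * y) v (c * d).
Proof.
case=> a [b [b0 -> ->]] [a' [b' [b'0 -> ->]]].
exists (a * a'), (b * b'); rewrite mevalM mulf_neq0 //; split=> //.
  by rewrite mulf_div -!frac_ofM.
by rewrite mulf_div !mevalM.
Qed.

Lemma ratfun_value_subst m (P : 'I_m -> ratfun k n) v w (g : {mpoly k[m]}) :
  ratmap_value P v w -> ratfun_value (eval_ratfun P g) v g.@[w].
Proof.
move=> Pvw; elim/mpoly_ring_ind: g => [c|i|f g|f g].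
- by rewrite eval_ratfunC mevalC -[c in X in ratfun_value _ _ X](mevalC v);
    exact: ratfun_value_frac_of.
- by rewrite eval_ratfunX mevalXU.
- by rewrite rmorphD mevalD; apply: ratfun_valueD.
- by rewrite rmorphM mevalM; apply: ratfun_valueM.
Qed.

End Values.

Lemma ratfun_value0_eq0 (x : ratfun k 2) d : d != 0 ->
  (forall v, d.@[v] != 0 -> ratfun_value x v 0) -> x = 0.
Proof.
move=> d0; have [a [b [b0 ->]]] := fractionP x => val0.
(* The factors [b] and [d] take care of the points where the value of a / b is not known to be 0. *)
suff /eqP: a * b * d = 0.
  by rewrite !mulf_eq0 (negPf b0) (negPf d0) !orbF => /eqP->; rewrite tofrac0 mul0r.
apply: mpoly2_eq0 => v; rewrite !mevalM; have [->|dv] := eqVneq d.@[v] 0.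
  by rewrite mulr0.
have [->|bv] := eqVneq b.@[v] 0; first by rewrite mulr0 mul0r.
have /eqP := ratfun_value_inj (val0 v dv) (ex_intro _ a (ex_intro _ b (And3 bv erefl erefl))).
by rewrite eq_sym mulf_eq0 invr_eq0 (negPf bv) orbF => /eqP->; rewrite !mul0r.
Qed.

Lemma generic_value m (P : 'I_m -> ratfun k 2) :
  exists2 d : {mpoly k[2]}, d != 0 &
    forall v, d.@[v] != 0 -> exists w, ratmap_value P v w.
Proof.
have [p [q [q0 defP]]] := common_denominator P; exists q => // v qv.
by exists (fun i => (p i).@[v] / q.@[v]) => i; exists (p i), q.
Qed.

(** The kernel of substitution is the vanishing ideal of the image, because [P] has a value wherever
    a common denominator is nonzero. *)
Lemma eval_ratfun_eq0 m (P : 'I_m -> ratfun k 2) g :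
  eval_ratfun P g = 0 <-> forall w, (exists v, ratmap_value P v w) -> g.@[w] = 0.
Proof.
split=> [g0 w [v Pvw]|g0].
  have := ratfun_value_subst g Pvw; rewrite g0 => /ratfun_value_inj; apply.
  by have := ratfun_value_frac_of 0 v; rewrite meval0 /frac_of tofrac0.
have [d d0 val] := generic_value P; apply: (ratfun_value0_eq0 d0) => v dv.
have [w Pvw] := val v dv; rewrite -(g0 w); last by exists v.
exact: ratfun_value_subst.
Qed.

End RationalMaps.

(** * Density of the image and properness in algebraic terms *)

Section Birationality.
Variable k : closedFieldType.
Implicit Types (S : set ('I_3 -> k)) (P : 'I_3 -> ratfun k 2).

(** Density of the image is restated through the kernel of substitution alone, a form that injective
    field morphisms preserve. *)
Lemma parametrizesP P S : parametrizes P S <->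
  forall w, S w <-> forall g, eval_ratfun P g = 0 -> g.@[w] = 0.
Proof.
have clE w : zariski_closure [set w | exists v, ratmap_value P v w]%classic w <->
    forall g, eval_ratfun P g = 0 -> g.@[w] = 0.
  split=> [cl g /eval_ratfun_eq0 g0|cl g g0]; first by apply: cl => u; apply: g0.
  by apply: cl; apply/eval_ratfun_eq0 => u; apply: g0.
split=> [<-//|SE]; rewrite /parametrizes predeqE => w.
by split=> [/clE|]; [move/SE | move/SE/clE].
Qed.

(** The components of [P] generate k(s, t) over k: this is properness in terms of function
    fields. *)
Definition generates_coordinates P (g h : 'I_2 -> {mpoly k[3]}) : Prop :=
  forall j, eval_ratfun P (h j) != 0 /\ frac_of 'X_j = eval_ratfun P (g j) / eval_ratfun P (h j).

(** One pair [G], [N] is used under two morphisms, substitution of [P] and evaluation at w. Under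
    the former the fractions g_j / h_j become the coordinates s and t. *)
Lemma eval_ratfun_clear P g h (a : {mpoly k[2]}) : generates_coordinates P g h ->
  exists G N, eval_ratfun P G = eval_ratfun P (\prod_j h j) ^+ N * frac_of a /\
    forall w, (forall j, (h j).@[w] != 0) ->
      G.@[w] = (\prod_j h j).@[w] ^+ N * a.@[fun j => (g j).@[w] / (h j).@[w]].
Proof.
move=> gen; have [G [N HG]] := clear_denominators g h a; exists G, N.
split=> [|w hw].
  rewrite HG => [|j]; last by case: (gen j).
  congr (_ * _); rewrite -[RHS]eval_ratfun_X /eval_ratfun /mmap; apply: eq_bigr => m _.
  congr (_ * _); first exact: eval_ratfunC.
  by apply: mmap1_eq => j; case: (gen j).
rewrite (HG _ (meval w)) //; congr (_ * _).
by apply: eq_bigr => m _; rewrite /= mevalC.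
Qed.

Lemma rmorph_common_power (R : nzRingType) (F : fieldType) (e : {rmorphism R -> F})
    (A B h : R) (a b : F) m n :
  e h != 0 -> b != 0 -> e A = e h ^+ m * a -> e B = e h ^+ n * b ->
  e (B * h ^+ m) != 0 /\ a / b = e (A * h ^+ n) / e (B * h ^+ m).
Proof.
move=> h0 b0 defA defB; have hn i : e h ^+ i != 0 by rewrite expf_neq0.
rewrite !rmorphM !rmorphXn /= defA defB; split; first by rewrite !mulf_neq0.
rewrite [e h ^+ m * a * _]mulrAC [e h ^+ n * b * _]mulrAC [e h ^+ n * e h ^+ m]mulrC.
by rewrite -mulf_div divff ?mul1r // mulf_neq0.
Qed.

Lemma generates_ratfun P g h (y : ratfun k 2) : generates_coordinates P g h ->
  exists G H, eval_ratfun P H != 0 /\ y = eval_ratfun P G / eval_ratfun P H.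
Proof.
move=> gen; have [a [b [b0 ->]]] := ratfunP y.
have [A [M [defA _]]] := eval_ratfun_clear a gen.
have [B [N [defB _]]] := eval_ratfun_clear b gen.
set h' := \prod_j h j in defA defB.
have h'0 : eval_ratfun P h' != 0.
  by rewrite rmorph_prod; apply/prodf_neq0 => j _; case: (gen j).
have fb0 : frac_of b != 0 by rewrite frac_of_eq0.
exists (A * h' ^+ N), (B * h' ^+ M).
exact: (rmorph_common_power h'0 fb0 defA defB).
Qed.

Lemma parametrizes_image P S v w : parametrizes P S -> ratmap_value P v w -> S w.
Proof.
by move=> /parametrizesP SE Pvw; apply/SE => g /eval_ratfun_eq0; apply; exists v.
Qed.

Lemma proper_generates P S : parametrizes P S -> proper_parametrization P S ->
  exists g h, generates_coordinates P g h.
Proof.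
move=> /parametrizesP SE [g [h [[w0 Sw0 hw0] inv _]]]; exists g, h.
have [d d0 val] := generic_value P.
set h' := \prod_j h j.
have h'E w : h'.@[w] = \prod_j (h j).@[w] by rewrite rmorph_prod.
have h'0 : eval_ratfun P h' != 0.
  apply/eqP => /((SE w0).1 Sw0)/eqP; rewrite h'E.
  by apply/negP; apply/prodf_neq0 => j _.
move=> j; have hj0 : eval_ratfun P (h j) != 0.
  by move: h'0; rewrite rmorph_prod => /prodf_neq0 /(_ j isT).
(* The factor [h'] makes the value 0 at the points where the inverse map is undefined; elsewhere the
   inverse recovers v from w. *)
have /eqP : eval_ratfun P h' * (frac_of 'X_j * eval_ratfun P (h j) + eval_ratfun P (- g j)) = 0.
  apply: (ratfun_value0_eq0 d0) => v /val [w Pvw].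
  have valS f : ratfun_value (eval_ratfun P f) v f.@[w] by exact: ratfun_value_subst.
  have X_val : ratfun_value (frac_of 'X_j) v (v j).
    by have := ratfun_value_frac_of 'X_j v; rewrite mevalXU.
  have -> : 0 = h'.@[w] * (v j * (h j).@[w] + (- g j).@[w]).
    have [->|h'w] := eqVneq h'.@[w] 0; first by rewrite mul0r.
    have hw i : (h i).@[w] != 0 by move: h'w; rewrite h'E => /prodf_neq0 /(_ i isT).
    by rewrite (inv v w) // divfK // mevalN subrr mulr0.
  apply: ratfun_valueM => //; apply: ratfun_valueD => //.
  exact: ratfun_valueM.
rewrite mulf_eq0 (negPf h'0) /= rmorphN subr_eq0 => /eqP <-.
by split=> //; rewrite mulfK.
Qed.

Lemma generates_proper P S g h : parametrizes P S ->
  generates_coordinates P g h -> proper_parametrization P S.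
Proof.
move=> paramP gen; have /parametrizesP SE := paramP; exists g, h.
set h' := \prod_j h j.
have h'E w : h'.@[w] = \prod_j (h j).@[w] by rewrite rmorph_prod.
have h'0 : eval_ratfun P h' != 0.
  by rewrite rmorph_prod; apply/prodf_neq0 => j _; case: (gen j).
split.
(* If [h'] vanished on the whole image of [P], its substitution would be 0. *)
- apply: contrapT => no_w; case/negP: h'0; apply/eqP/eval_ratfun_eq0 => w [v Pvw].
  apply/eqP; apply: contraT => h'w; case: no_w; exists w.
    exact: parametrizes_image Pvw.
  by move=> j; move: h'w; rewrite h'E => /prodf_neq0 /(_ j isT).
- move=> v w Pvw hw j; apply: (canRL (mulfK (hw j))).
  have [hj0 _] := gen j.
  apply: (@ratfun_value_inj _ _ (eval_ratfun P (g j)) v); last exact: ratfun_value_subst.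
  rewrite -[eval_ratfun P (g j)](divfK hj0) -(gen j).2; apply: ratfun_valueM.
    by have := ratfun_value_frac_of 'X_j v; rewrite mevalXU.
  exact: ratfun_value_subst.
- move=> w u Sw hw Pu i; have [a [b [b0 defP ->]]] := Pu i.
  have [A [M [defA valA]]] := eval_ratfun_clear a gen.
  have [B [N [defB valB]]] := eval_ratfun_clear b gen.
  have fb0 : frac_of b != 0.
    by rewrite frac_of_eq0; apply: contraNneq b0 => ->; rewrite meval0.
  (* The point w of [S] may lie outside the image of [P], so the relation P_i b = a is first turned
     into a polynomial in the kernel, which vanishes on all of [S]. *)
  have /((SE w).1 Sw) : eval_ratfun P (h' ^+ N * A - 'X_i * (h' ^+ M * B)) = 0.
    rewrite rmorphB !rmorphM !rmorphXn /= eval_ratfunX defA defB defP.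
    rewrite [X in _ - X]mulrCA [_ / _ * _]mulrCA divfK //.
    by rewrite mulrCA subrr.
  rewrite mevalB !mevalM !rmorphXn /= mevalXU valA // valB //.
  have h'w : h'.@[w] != 0 by rewrite h'E; apply/prodf_neq0 => j _.
  rewrite [X in X - _]mulrCA [w i * _]mulrCA [w i * _]mulrCA -!mulrBr => /eqP.
  rewrite !mulf_eq0 !expf_eq0 (negPf h'w) !andbF /= subr_eq0 => /eqP->.
  by rewrite mulfK.
Qed.

End Birationality.

(** * Transport along an automorphism [Psi] of k(s, t) over k *)

Section Automorphism.
Variables (k : closedFieldType) (Psi : {rmorphism ratfun k 2 -> ratfun k 2}).
Hypothesis PsiC : forall c : k, Psi (frac_of c%:MP) = frac_of c%:MP.
Hypothesis Psi_surj : forall y, exists x, Psi x = y.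
Implicit Types (S : set ('I_3 -> k)) (P : 'I_3 -> ratfun k 2).

Lemma eval_ratfun_comp n (P : 'I_n -> ratfun k 2) g :
  Psi (eval_ratfun P g) = eval_ratfun (fun i => Psi (P i)) g.
Proof.
apply: (@eq_mpoly_rmorph _ _ _ (Psi \o eval_ratfun P)
  (eval_ratfun (fun i => Psi (P i)))) => [c|i] /=; first by rewrite !eval_ratfunC PsiC.
by rewrite !eval_ratfunX.
Qed.

Lemma parametrizes_comp P S :
  parametrizes P S -> parametrizes (fun i => Psi (P i)) S.
Proof.
move=> /parametrizesP SE; apply/parametrizesP => w; apply: (iff_trans (SE w)).
split=> g0 g; have := g0 g; rewrite -eval_ratfun_comp.
  by move=> H /eqP; rewrite fmorph_eq0 => /eqP.
by move=> H Pg0; apply: H; rewrite Pg0 rmorph0.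
Qed.

Lemma function_field_image_comp P S u :
  function_field_image (fun i => Psi (P i)) S (Psi u) <-> function_field_image P S u.
Proof.
split=> -[g [h [Sh]]]; rewrite !poly_subst_eval => def_u; exists g, h; split=> //.
  by apply: (fmorph_inj Psi); rewrite def_u fmorph_div !eval_ratfun_comp.
by rewrite def_u fmorph_div !eval_ratfun_comp.
Qed.

(** [Psi] is bijective and matches the two copies of k(S), so it carries bases to bases in both
    directions. *)
Lemma map_degree_comp P S d :
  map_degree P S d <-> map_degree (fun i => Psi (P i)) S d.
Proof.
split=> -[b [b_span b_free]].
  exists (fun i => Psi (b i)); split=> [y|c Kc].
    have [x <-] := Psi_surj y; have [c Kc ->] := b_span x.
    exists (fun i => Psi (c i)) => [i|]; first exact/function_field_image_comp.
    by rewrite rmorph_sum; apply: eq_bigr => i _; rewrite rmorphM.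
  have /choice [c' def_c] i := Psi_surj (c i).
  have Kc' i : function_field_image P S (c' i).
    by apply/function_field_image_comp; rewrite def_c.
  move=> sum0 i; rewrite -def_c b_free ?rmorph0 //.
  apply: (fmorph_inj Psi); rewrite rmorph0 rmorph_sum -[RHS]sum0.
  by apply: eq_bigr => j _; rewrite rmorphM /= def_c.
have /choice [b' def_b] i := Psi_surj (b i).
exists b'; split=> [x|c Kc sum0].
  have [c Kc def_x] := b_span (Psi x); have /choice [c' def_c] i := Psi_surj (c i).
  exists c' => [i|]; first by apply/function_field_image_comp; rewrite def_c.
  apply: (fmorph_inj Psi); rewrite def_x rmorph_sum.
  by apply: eq_bigr => j _; rewrite rmorphM /= def_c def_b.
move=> i; apply: (fmorph_inj Psi); rewrite rmorph0.
apply: (b_free (fun j => Psi (c j))) => [j|]; first exact/function_field_image_comp.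
have := congr1 Psi sum0; rewrite rmorph0 rmorph_sum => PsiS; rewrite -[RHS]PsiS.
by apply: eq_bigr => j _; rewrite rmorphM /= def_b.
Qed.

Lemma proper_comp P S : parametrizes P S ->
  proper_parametrization P S -> proper_parametrization (fun i => Psi (P i)) S.
Proof.
move=> paramP /(proper_generates paramP) [g [h gen]].
have /choice [G /choice [H GH]] : forall j : 'I_2, exists G H,
    eval_ratfun (fun i => Psi (P i)) H != 0 /\
    frac_of 'X_j = eval_ratfun (fun i => Psi (P i)) G / eval_ratfun (fun i => Psi (P i)) H.
  (* The preimage of a coordinate under [Psi] is a rational expression in [P]; applying [Psi]
     expresses the coordinate through the new components. *)
  move=> j; have [x def_x] := Psi_surj (frac_of 'X_j).
  have [G [H [H0 x_GH]]] := generates_ratfun x gen; exists G, H.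
  by rewrite -!eval_ratfun_comp fmorph_eq0 -fmorph_div -x_GH.
exact: generates_proper (parametrizes_comp paramP) GH.
Qed.

End Automorphism.

(** * Coprime forms and the location of the base points *)

Section BasePoints.
Variable k : closedFieldType.

(** A common denominator of least total degree works: cancelling a nonconstant common divisor would
    lower the degree. *)
Lemma common_form_exists (P : 'I_3 -> ratfun k 2) :
  exists p q, common_denominator_form P p q.
Proof.
have [|_ [p [q [q0 defP <-]]] min_q] := @ex_minimal (fun n =>
    exists p q, [/\ q != 0, forall i, P i = frac_of (p i) / frac_of q & msize q = n]).
  by have [p [q [q0 defP]]] := common_denominator P; exists (msize q), p, q.
exists p, q; split=> // d [c def_q] /choice [p' def_p].
move: q0; rewrite def_q mulf_eq0 negb_or => /andP[c0 d0].
have: (msize q <= msize c)%N.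
  apply: min_q; exists p', c; split=> // i.
  by rewrite defP def_p def_q !frac_ofM -mulf_div divff ?mulr1 ?frac_of_eq0.
rewrite def_q msizeM // => le_cd.
(* [msize] is the total degree plus one, so the size of a product of nonzero factors is the sum of
   their sizes minus one. *)
have sz_d : (msize d <= 1)%N.
  move: le_cd; have : (0 < msize c)%N by rewrite lt0n msize_poly_eq0.
  case: (msize c) => // s _; case: (msize d) => [|[|t]] //.
  by rewrite !addnS /= ltnNge addSn ltnS leq_addr.
rewrite [d]msize1_polyC // in d0 *.
by apply: rmorph_unit; rewrite unitfE; apply: contraNneq d0 => ->; rewrite mpolyC0.
Qed.

Lemma eliminate_base_points (p : 'I_3 -> {mpoly k[2]}) q : q != 0 ->
  (forall d : {mpoly k[2]}, (exists c, q = c * d) ->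
    (forall i, exists c, p i = c * d) -> d \is a GRing.unit) ->
  exists (h : {poly k}) b, h != 0 /\
    forall v, common_zero p q v -> h.[v 0] = 0 /\ v 1 != b.
Proof.
move=> q0 coprime.
(* The ideal generated by the p_i and q, read in [{poly {poly k}}]; its members vanish at every base
   point. *)
pose I f := exists u w, of_biv f = \sum_i u i * p i + w * q.
have I0 f v : I f -> common_zero p q v -> f.[(v 1)%:P].[v 0] = 0.
  case=> u [w def_f] [pv qv]; rewrite -[f]of_bivK -meval_to_biv def_f.
  rewrite mevalD mevalM qv mulr0 addr0 rmorph_sum big1 // => i _.
  by rewrite rmorphM /= pv mulr0.
have [||||h [b [h0 Ih Hb]]] := @separating_line k I.
- move=> f g [u [w def_f]] [u' [w' def_g]].
  exists (fun i => u i + u' i), (w + w'); rewrite rmorphD /= def_f def_g.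
  rewrite addrACA -big_split mulrDl; congr (_ + _).
  by apply: eq_bigr => i _; rewrite mulrDl.
- move=> f g [u [w def_f]].
  exists (fun i => of_biv g * u i), (of_biv g * w); rewrite rmorphM /= def_f.
  rewrite mulrDr mulrA mulr_sumr; congr (_ + _).
  by apply: eq_bigr => i _; rewrite mulrA.
- exists (to_biv q); last by rewrite raddf_eq0 //; exact: (can_inj (@to_bivK k)).
  exists (fun _ => 0), 1; rewrite to_bivK mul1r big1 ?add0r // => i _.
  by rewrite mul0r.
- move=> d dvd_d; have dvd_of f : I (to_biv f) -> exists c, f = c * of_biv d.
    case/dvd_d => e def_f; exists (of_biv e).
    by rewrite -rmorphM -def_f to_bivK.
  rewrite -[d]of_bivK; apply: rmorph_unit; apply: coprime => [|i]; apply: dvd_of.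
    exists (fun _ => 0), 1; rewrite to_bivK mul1r big1 ?add0r // => i _.
    by rewrite mul0r.
  exists (fun j => (j == i)%:R), 0; rewrite to_bivK mul0r addr0.
  rewrite (bigD1 i) //= eqxx mul1r big1 ?addr0 // => j /negPf->.
  by rewrite mul0r.
exists h, b; split=> // v zv; have hv : h.[v 0] = 0.
  by have := I0 _ _ Ih zv; rewrite hornerC.
split=> //; have [f If] := Hb _ hv; apply: contraNneq => <-.
by rewrite (I0 f).
Qed.

(** * The shear and the automorphism of k(s, t) that it induces *)

Section Reparametrization.
Variables (h : {poly k}) (c : k).
Hypothesis h_neq0 : h != 0.

(* The birational map (s, t) |-> (s, c + t h(s)): it contracts the lines
   h(s) = 0 to points with second coordinate c. *)
Definition shear (i : 'I_2) : {mpoly k[2]} :=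
  if i == 0 then 'X_0 else c%:MP + 'X_1 * of_poly h.

Definition shear_comp : {rmorphism {mpoly k[2]} -> {mpoly k[2]}} :=
  mmap (@mpolyC 2 k) shear.

Lemma meval_shear_comp f v :
  (shear_comp f).@[v] = f.@[fun i => (shear i).@[v]].
Proof.
apply: (@eq_mpoly_rmorph _ _ _ (meval v \o shear_comp)
  (meval (fun i => (shear i).@[v]))) => [a|i] /=.
  by rewrite [shear_comp _]mmapC !mevalC.
by rewrite [shear_comp _]mmapX mmap1U mevalXU.
Qed.

Lemma meval_shear v i :
  (shear i).@[v] = if i == 0 then v 0 else c + v 1 * h.[v 0].
Proof.
rewrite /shear; case: ifP => _; first by rewrite mevalXU.
by rewrite mevalD mevalM mevalC mevalXU meval_of_poly.
Qed.

Lemma shear_comp_neq0 f : f != 0 -> shear_comp f != 0.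
Proof.
apply: contraNneq => f0; suff /eqP : f * of_poly h = 0.
  by rewrite mulf_eq0 (negPf (of_poly_neq0 h_neq0)) orbF.
apply: mpoly2_eq0 => v; rewrite mevalM meval_of_poly.
have [->|hv] := eqVneq h.[v 0] 0; first by rewrite mulr0.
(* [u] is the preimage of v under the shear, available off the lines h(s) = 0. *)
pose u (i : 'I_2) := if i == 0 then v 0 else (v 1 - c) / h.[v 0].
suff -> : f.@[v] = 0 by rewrite mul0r.
have := congr1 (meval u) f0; rewrite meval0 => <-; rewrite meval_shear_comp; apply: meval_eq => i.
rewrite meval_shear /u /=; case: eqVneq => [->//|].
case: i => -[|[|//]] // lt_i2 _; rewrite divfK // addrC subrK.
by congr v; apply: val_inj.
Qed.

Lemma shear_comp_of_poly : shear_comp (of_poly h) = of_poly h.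
Proof.
apply/eqP; rewrite -subr_eq0; apply/eqP/mpoly2_eq0 => v.
by rewrite mevalB meval_shear_comp !meval_of_poly meval_shear subrr.
Qed.

Lemma shear_automorphism : exists Psi : {rmorphism ratfun k 2 -> ratfun k 2},
  (forall f, Psi (frac_of f) = frac_of (shear_comp f)) /\
  (forall y, exists x, Psi x = y).
Proof.
have [|Psi PsiE] := @fraction_lift _ (ratfun k 2)
    (@FracField.tofrac {mpoly k[2]} \o shear_comp).
  by move=> f f0 /=; rewrite frac_of_eq0 shear_comp_neq0.
exists Psi; split=> [f|y]; first exact: PsiE.
have PsiF f : Psi (frac_of f) = frac_of (shear_comp f) := PsiE f.
have PsiC a : Psi (frac_of a%:MP) = frac_of a%:MP.
  by rewrite PsiF [shear_comp _]mmapC.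
(* The inverse map (s, (t - c) / h(s)), which yields preimages under [Psi]. *)
pose x (i : 'I_2) : ratfun k 2 := if i == 0 then frac_of 'X_0
  else (frac_of 'X_1 - frac_of c%:MP) / frac_of (of_poly h).
have Psi_x i : Psi (x i) = frac_of 'X_i.
  rewrite /x; case: eqVneq => [->|].
    by rewrite PsiF [shear_comp _]mmapX mmap1U.
  case: i => -[|[|//]] // lt_i2 _; rewrite fmorph_div rmorphB /= !PsiF.
  rewrite shear_comp_of_poly [shear_comp _]mmapX mmap1U [shear_comp _]mmapC.
  rewrite /shear /= frac_ofD addrC addKr frac_ofM mulfK.
    by congr (frac_of 'X__); apply: val_inj.
  by rewrite frac_of_eq0; apply: of_poly_neq0.
have Psi_subst f : Psi (eval_ratfun x f) = frac_of f.
  rewrite eval_ratfun_comp // -eval_ratfun_X /eval_ratfun /mmap; apply: eq_bigr => m _.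
  by congr (_ * _); apply: mmap1_eq.
have [a [b [_ ->]]] := ratfunP y; exists (eval_ratfun x a / eval_ratfun x b).
by rewrite fmorph_div !Psi_subst.
Qed.

End Reparametrization.

End BasePoints.

Theorem theorem4p1 (k : closedFieldType) (char_k : [pchar k] =i pred0)
    (S : set ('I_3 -> k)) (P : 'I_3 -> ratfun k 2) :
  surface S -> parametrizes P S -> (forall i, nonconstant (P i)) ->
  exists (psi : 'I_2 -> ratfun k 2) (Q : 'I_3 -> ratfun k 2),
    ratmap_comp P psi Q /\
    parametrizes Q S /\
    no_affine_base_points Q /\
    (forall d : nat, map_degree P S d <-> map_degree Q S d) /\
    (proper_parametrization P S -> proper_parametrization Q S).
Proof.
move=> _ paramP _; have [p [q [q0 defP coprime_pq]]] := common_form_exists P.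
have [h [c [h0 base]]] := eliminate_base_points q0 coprime_pq.
have [Psi [PsiF Psi_surj]] := shear_automorphism c h0.
have PsiC a : Psi (frac_of a%:MP) = frac_of a%:MP.
  by rewrite PsiF [shear_comp _ _ _]mmapC.
have sq0 := shear_comp_neq0 c h0 q0.
exists (fun i => frac_of (shear h c i)), (fun i => Psi (P i)); split=> [i|].
  exists (p i), q; rewrite !poly_subst_eval !eval_ratfun_frac_of.
  by split; rewrite ?frac_of_eq0 // defP fmorph_div !PsiF.
split; first exact: parametrizes_comp.
split; last first.
  by split=> [d|]; [exact: map_degree_comp | exact: proper_comp].
(* The shear would send a common zero to a base point of [P]; there h(s) = 0, so its second
   coordinate is c, which the choice of c excludes. *)
have no_zero v :
    ~ common_zero (fun i => shear_comp h c (p i)) (shear_comp h c q) v.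
  case=> pv qv; have [|] := base (fun i => (shear h c i).@[v]).
    by split=> [i|]; rewrite -meval_shear_comp.
  by rewrite !meval_shear /= => ->; rewrite mulr0 addr0 eqxx.
exists (fun i => shear_comp h c (p i)), (shear_comp h c q); split=> //.
split=> // [i|d [e def_q] dvd_p]; first by rewrite defP fmorph_div !PsiF.
(* Coprimality follows from the absence of common zeros: a zero of a common divisor would be one. *)
apply: mpoly2_no_zero_unit => v; apply/eqP => dv; apply: (no_zero v).
split=> [i|]; last by rewrite def_q mevalM dv mulr0.
by have [f ->] := dvd_p i; rewrite mevalM dv mulr0.
Qed.
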